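(* Let $q$ be any prime power and let $\delta$, $n$, $r$ be positive integers with $r+1\leq \delta\leq n-r$. Let $\mathcal F$ be an $m\times n$ Ferrers diagram with column counts $\gamma_0,\dots,\gamma_{n-1}$ satisfying (1) $\gamma_{n-r-1}\leq n-r$; (2) $\gamma_{n-r+i}\geq n-r+\sum_{j=0}^{i}\gamma_j$ for every $i\in\{0,1,\dots,r-1\}$; (3) $\gamma_i\geq n-r$ for every $i$ with $n-\delta+1\leq i\leq n-1$. Then there exists an optimal $[\mathcal F,\sum_{i=0}^{n-\delta}\gamma_i,\delta]_q$ code.
   Context: $[a]$ denotes $\{0,1,\dots,a-1\}$; rows and columns of an $m\times n$ matrix are indexed by $[m]$ and $[n]$. An $m\times n$ Ferrers diagram is a set $\mathcal F\subseteq[m]\times[n]$ of cells (''dots'') such that: if $(i,j)\in\mathcal F$ and $i\ge1$ then $(i-1,j)\in\mathcal F$; if $(i,j)\in\mathcal F$ and $j\le n-2$ then $(i,j+1)\in\mathcal F$; row $0$ contains $n$ dots and column $n-1$ contains $m$ dots. $\gamma_j$ denotes the number of dots in column $j$. For an $m\times n$ Ferrers diagram $\mathcal F$, an $[\mathcal F,k,\delta]_q$ code is a $k$-dimensional $\mathbb F_q$-linear subspace $\mathcal C\subseteq\mathbb F_q^{m\times n}$ such that every matrix in $\mathcal C$ has zero entries in all positions not in $\mathcal F$, and every nonzero matrix of $\mathcal C$ has rank at least $\delta$. Such a code is called optimal if $k=\min_{i\in[\delta]}v_i$, where $v_i$ is the number of dots of $\mathcal F$ that lie neither in the first $i$ rows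 nor in the rightmost $\delta-1-i$ columns (it is known that always $k\le \min_{i\in[\delta]} v_i$). *)

(* Defs.v *)
From HB Require Import structures.
From mathcomp Require Import all_boot all_order all_algebra.

Set Implicit Arguments.
Unset Strict Implicit.
Unset Printing Implicit Defensive.

Import GRing.Theory.

Section FerrersDiagrams.

Variables m n : nat.
Implicit Type D : {set 'I_m * 'I_n}.

(* Rows and columns are designated by natural numbers; an index out of range
   designates an empty row or column. *)
Definition row_dots D (i : nat) : nat := #|[set d in D | d.1 == i :> nat]|.

Definition col_dots D (j : nat) : nat := #|[set d in D | d.2 == j :> nat]|.

(* Rows are numbered from the top and columns from the left: the dots of a
   Ferrers diagram are top-aligned and right-aligned. *)
Definition ferrers_diagram D : Prop :=
  [/\ forall (i i' : 'I_m) (j : 'I_n),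
        i = i'.+1 :> nat -> (i, j) \in D -> (i', j) \in D,
      forall (i : 'I_m) (j j' : 'I_n),
        j' = j.+1 :> nat -> (i, j) \in D -> (i, j') \in D,
      row_dots D 0 = n
    & col_dots D n.-1 = m].

(* The number v_i of dots lying neither in the first i rows nor in the
   rightmost delta - 1 - i columns. *)
Definition remaining_dots D (delta i : nat) : nat :=
  #|[set d in D | (i <= d.1) && (d.2 < n - (delta - 1 - i))]|.

(* min_{i in [delta]} v_i. The default value v_0 of the iterated minimum is
   itself one of the v_i as soon as delta > 0. *)
Definition dim_bound D (delta : nat) : nat :=
  \big[minn/remaining_dots D delta 0]_(i < delta) remaining_dots D delta i.

Variable F : finFieldType.
Implicit Type C : {vspace 'M[F]_(m, n)}.

Definition ferrers_code D (k delta : nat) C : Prop :=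
  [/\ \dim C = k,
      forall A : 'M[F]_(m, n), A \in C ->
        forall (i : 'I_m) (j : 'I_n), (i, j) \notin D -> A i j = 0%R
    & forall A : 'M[F]_(m, n), A \in C -> A != 0%R -> delta <= \rank A].

Definition optimal_ferrers_code D (k delta : nat) C : Prop :=
  ferrers_code D k delta C /\ k = dim_bound D delta.

End FerrersDiagrams.

(* Main.v *)
(* Let N = n - r, k = n - delta + 1 and q = #|F|. The first N rows of a codeword
   are the coordinates of a vector (c_0, ..., c_{n-1}) over the extension L of
   degree N of F, where c_0, ..., c_{k-1} are free information symbols, cut down
   to gamma_j coordinates. The encoder is chosen so that, for every t, the
   codewords with c_0 = ... = c_{t-1} = 0 form, on the columns t, ..., t + N - 1,
   a Gabidulin code of dimension k - t. Such an encoder exists by induction on k: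
   a linearized polynomial f of q-degree < k that vanishes at the first
   evaluation point a factors as g o (x^q - a^(q-1) x), so that the codewords
   with c_0 = 0 form a Gabidulin code of dimension k - 1 evaluated at N - 1
   independent points, to which an N-th point can be added. In the last r columns
   the information coordinates are repeated below row N so that, if t <= r is maximal
   with c_0 = ... = c_{t-1} = 0, below row N the last r - t columns are in
   echelon form and all other columns vanish. The kernel of such a matrix is then
   supported on the first t + N columns, so it has at most q^(k-1) elements and
   the rank is at least n - (k - 1) = delta. *)

Require Import Defs.
From HB Require Import structures.
From mathcomp Require Import all_boot all_order all_algebra.
From mathcomp Require Import all_fingroup all_field mxabelem zify.

Set Implicit Arguments.
Unset Strict Implicit.
Unset Printing Implicit Defensive.

Import GRing.Theory passmx.

Local Open Scope ring_scope.

(** * Finite fields: extensions of prescribed degree *)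

Lemma fieldExt_of_dim (F : finFieldType) (N : nat) :
  (0 < N)%N -> exists L : fieldExtType F, \dim {: L} = N.
Proof.
move=> N_gt0; pose q := #|F|; pose m := (q ^ N)%N.
have q_gt1 : (1 < q)%N := finNzRing_gt1 F.
have m_gt1 : (1 < m)%N by rewrite (ltn_exp2l 0).
pose P (R : nzRingType) : {poly R} := 'X^m - 'X.
have sizeP R : size (P R) = m.+1.
  by rewrite size_polyDl size_polyXn // size_polyN size_polyX.
have P_neq0 R : P R != 0 by rewrite -size_poly_eq0 sizeP.
have [L [zs PzE zsL]] := FinSplittingFieldFor (P_neq0 F).
rewrite rmorphB rmorphXn /= map_polyX -/(P L) in PzE.
have m0 : m%:R = 0 :> L.
  have [p _ pF] := finPcharP F.
  have mE : m = (p ^ (logn p q * N))%N by rewrite expnM -(card_pprimeChar pF).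
  have e_neq0 : (logn p q * N)%N != 0%N.
    by apply: contraTneq m_gt1 => e0; rewrite mE e0.
  by rewrite mE natrX pcharf0 ?pchar_lalg // expr0n (negPf e_neq0).
(* As [m] vanishes in [L], the derivative of [P L] is -1, so the roots are distinct. *)
have zs_uniq : uniq zs.
  rewrite -separable_prod_XsubC -(eqp_separable PzE).
  rewrite unlock derivB derivXn derivX -mulr_natl -polyC_natr m0 mul0r sub0r.
  by rewrite -scaleN1r coprimepZr ?coprimep1 // oppr_eq0 oner_eq0.
have size_zs : size zs = m.
  by apply: succn_inj; rewrite -(sizeP L) (eqp_size PzE) size_prod_XsubC.
have rootP z : root (P L) z = (z ^+ m == z).
  by rewrite rootE !hornerE subr_eq0.
have [a _ aE] := finField_galois_generator (sub1v {: L}%AS).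
have frobE (x : L) : (a ^+ N)%g x = x ^+ m.
  rewrite /m; elim: (N) => [|i IHi]; first by rewrite gal_id.
  by rewrite expgSr expnSr exprM galM ?memvf // IHi aE ?memvf // dimv1 expn1.
have all_fix (x : L) : x ^+ m = x.
  rewrite -frobE; apply/fixedSpaceP.
  (* The fixed space is a subfield containing the roots [zs], and these generate [L]. *)
  suffices -> : fixedSpace (a ^+ N)%g = {: L}%VS by apply: memvf.
  apply/eqP; rewrite eqEsubv subvf -zsL -[fixedSpace _]subfield_closed agenvS //.
  rewrite subv_add sub1v; apply/span_subvP => z.
  rewrite -root_prod_XsubC -(eqp_root PzE) rootP => /eqP zm.
  by apply/fixedSpaceP; rewrite frobE.
pose K := finvect_type L; exists L.
apply/eqP; rewrite -(eqn_exp2l _ _ q_gt1) -/m -size_zs.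
have <- : #|{: K}| = (q ^ \dim {: L})%N.
  by rewrite -(@card_vspace F K _ fullv); apply: eq_card => z; rewrite memvf.
rewrite -(card_uniqP (zs_uniq : uniq (zs : seq K))); apply/eqP/eq_card => z.
by rewrite -[RHS]root_prod_XsubC -(eqp_root PzE) rootP all_fix eqxx.
Qed.

(** * Linearized polynomials over the extension *)

Section Linearized.

Variables (F : finFieldType) (L : fieldExtType F).
Implicit Types (a x y : L) (s : seq L) (f : L -> L) (k : nat).

Local Notation q := #|F|.

Lemma card_finField_gt0 : (0 < q)%N.
Proof. exact: ltnW (finNzRing_gt1 F). Qed.

Lemma pchar_nat_card i : [pchar L].-nat (q ^ i)%N.
Proof.
have [p _ pF] := finPcharP F.
have pL : p \in [pchar L] by rewrite pchar_lalg.
rewrite (card_pprimeChar pF) -expnM (eq_pnat _ (pcharf_eq pL)).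
by rewrite pnatX pnat_id ?(pcharf_prime pF).
Qed.

Lemma expr_card_linear i c x y :
  (c *: x + y) ^+ (q ^ i) = c *: x ^+ (q ^ i) + y ^+ (q ^ i).
Proof.
rewrite exprDn_pchar ?pchar_nat_card // exprZn; congr (_ *: _ + _).
by elim: i => // i IHi; rewrite expnSr exprM IHi expf_card.
Qed.

Definition linearized k f :=
  exists a : nat -> L, forall x, f x = \sum_(i < k) a i * x ^+ (q ^ i).

Lemma linearizedP k f : linearized k f -> linear f.
Proof.
case=> a fE c x y; rewrite !fE scaler_sumr -big_split /=.
by apply: eq_bigr => i _; rewrite expr_card_linear mulrDr scalerAr.
Qed.

Lemma linearized0 k f : linearized k f -> f 0 = 0.
Proof.
case=> a ->; rewrite big1 // => i _.
by rewrite expr0n expn_eq0 gtn_eqF ?card_finField_gt0 ?mulr0.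
Qed.

Lemma linearized_comb k f g b c : linearized k f -> linearized k g ->
  linearized k (fun x => b * f x + c * g x).
Proof.
move=> [a fE] [a' gE]; exists (fun i => b * a i + c * a' i) => x.
rewrite fE gE !mulr_sumr -big_split /=.
by apply: eq_bigr => i _; rewrite mulrDl !mulrA.
Qed.

(** For nonzero [a], this is the product of the factors x - z over all z in the [F]-line of [a]. *)
Definition annihilator a x := x ^+ q - a ^+ q.-1 * x.

Lemma annihilator_linear a : linear (annihilator a).
Proof.
move=> c x y; rewrite /annihilator scalerBr -[q]expn1 expr_card_linear expn1.
by rewrite mulrDr scalerAr opprD addrACA.
Qed.

HB.instance Definition _ a :=
  GRing.isLinear.Build F L L *:%R (annihilator a) (@annihilator_linear a).

Lemma annihilator_id a : annihilator a a = 0.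
Proof. by rewrite /annihilator -exprSr prednK ?card_finField_gt0 ?subrr. Qed.

(** The quotient [x / a] is fixed by the q-th power map, hence lies in [F]. *)
Lemma annihilator_eq0 a x : a != 0 -> annihilator a x = 0 -> x \in <[a]>%VS.
Proof.
move=> a0 /eqP; rewrite subr_eq0 => /eqP xq.
have : x / a \in 1%AS.
  rewrite Fermat's_little_theorem dimv1 expn1 expr_div_n xq.
  rewrite -[X in _ / _ ^+ X](prednK card_finField_gt0) exprSr.
  by rewrite -mulf_div divff ?expf_neq0 // mul1r.
case/vlineP=> c /(canRL (divfK a0)) ->.
by rewrite -scalerAl mul1r memvZ ?memv_line.
Qed.

(** The kernel of [annihilator a] is the line of [a], which meets the span of [s] only in 0. *)
Lemma free_annihilator a s : free (a :: s) -> free (map (annihilator a) s).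
Proof.
move=> fas; have := fas; rewrite free_cons => /andP[as_ fs].
have a0 : a != 0 by apply: contraNneq as_ => ->; apply: mem0v.
have -> : map (annihilator a) s = map (linfun (annihilator a)) s.
  by apply: eq_map => x; rewrite lfunE.
rewrite /free -limg_span size_map limg_dim_eq //.
apply/eqP; rewrite -subv0; apply/subvP=> x; rewrite memv_cap memv_ker lfunE /=.
case/andP=> xs /eqP /(annihilator_eq0 a0) /vlineP[c xE].
rewrite memv0 xE; apply: contraNT as_ => ca.
have c0 : c != 0 by apply: contraNneq ca => ->; rewrite scale0r.
by rewrite -(scalerK c0 a) -xE memvZ.
Qed.

Lemma linearized_annihilator k f a : linearized k f ->
  linearized k.+1 (fun x => f (annihilator a x)).
Proof.
case=> b fE.
(* The coefficients of the composite are b_(i-1) - b_i a^((q-1) q^i), where b is read as 0 outside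
   [k]. *)
exists (fun i => (if i is j.+1 then b j else 0)
                 - (if (i < k)%N then b i * (a ^+ q.-1) ^+ (q ^ i) else 0)) => x.
have pE i : annihilator a x ^+ (q ^ i)
    = x ^+ (q ^ i.+1) - (a ^+ q.-1) ^+ (q ^ i) * x ^+ (q ^ i).
  rewrite /annihilator addrC -scaleN1r expr_card_linear scaleN1r -exprM -expnS.
  by rewrite addrC exprMn.
under [RHS]eq_bigr do rewrite mulrBl.
rewrite sumrB [X in _ = X - _]big_ord_recl [X in _ = _ - X]big_ord_recr /=.
rewrite mul0r add0r ltnn mul0r addr0 fE -sumrB; apply: eq_bigr => i _.
by rewrite pE ltn_ord mulrBr mulrA.
Qed.

(** Each point [y] of [s] is removed by composing with [annihilator y]. This costs one q-degree and
    keeps the images of the other points independent. *)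
Lemma exists_interpolant x s : free (x :: s) ->
  exists2 f, linearized (size s).+1 f & f x = 1 /\ {in s, forall y, f y = 0}.
Proof.
move: {2}(size s) (erefl (size s)) => k; elim: k x s => [|k IHk] x [|y s] //= sz_s.
  rewrite free_cons span_nil memv0 => /andP[x0 _].
  exists (fun y => x^-1 * y); last by rewrite mulVf.
  by exists (fun=> x^-1) => z; rewrite big_ord1 expn0 expr1.
move=> fxys; case: sz_s => sz_s; have fyxs : free (y :: x :: s).
  by rewrite (perm_free (permEl (perm_catCA [:: y] [:: x] s))).
have [|f f_lin [fx f0]] := IHk _ _ _ (free_annihilator fyxs).
  by rewrite size_map.
exists (fun z => f (annihilator y z)).
  by have := linearized_annihilator y f_lin; rewrite size_map.
split=> // z; rewrite inE => /predU1P[-> | zs]; last by apply/f0/map_f.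
by rewrite annihilator_id (linearized0 f_lin).
Qed.

(** Combining the points of [al] with coefficients [v] gives a root of [f], and independence makes
    distinct [v] give distinct roots. As a nonzero polynomial, [f] has degree at most q^(k-1). *)
Lemma card_linearized_roots k f (N : nat) (al : N.-tuple L) :
    linearized k f -> free al -> (exists x, f x != 0) ->
  (#|[set v : {ffun 'I_N -> F} | (\sum_j v j *: f al`_j == 0)%R]| <= q ^ k.-1)%N.
Proof.
move=> f_lin fal [x fx]; have [a fE] := f_lin.
have k_gt0 : (0 < k)%N.
  by case: k fE {f_lin} => // fE; rewrite fE big_ord0 eqxx in fx.
pose p : {poly L} := \sum_(i < k) a i *: 'X^(q ^ i).
have pE y : p.[y] = f y.
  by rewrite fE horner_sum; apply: eq_bigr => i _; rewrite hornerZ hornerXn.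
have p_neq0 : p != 0 by apply: contraNneq fx => p0; rewrite -pE p0 horner0.
have size_p : (size p <= (q ^ k.-1).+1)%N.
  apply: leq_trans (size_sum _ _ _) _; apply/bigmax_leqP => i _.
  apply: leq_trans (size_scale_leq _ _) _; rewrite size_polyXn ltnS.
  by rewrite leq_pexp2l ?card_finField_gt0 // -ltnS prednK.
set A := [set _ | _].
pose comb (v : {ffun 'I_N -> F}) := \sum_j v j *: (al`_j).
have comb_inj : injective comb.
  move=> v w /eqP; rewrite -subr_eq0 -sumrB => /eqP vw; apply/ffunP => j.
  apply/eqP; rewrite -subr_eq0; apply/eqP; move: j.
  have /freeP/(_ (fun j => v j - w j)) := fal; apply; rewrite -[RHS]vw.
  by apply: eq_bigr => j _; rewrite scalerBl.
have f_comb v : f (comb v) = \sum_j v j *: f al`_j.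
  have fD y z : f (y + z) = f y + f z.
    by have := linearizedP f_lin 1 y z; rewrite !scale1r.
  have fZ c y : f (c *: y) = c *: f y.
    by have := linearizedP f_lin c y 0; rewrite !addr0 (linearized0 f_lin) addr0.
  rewrite /comb; elim/big_rec2: _ => [|j y z _ <-]; first exact: linearized0 f_lin.
  by rewrite fD fZ.
rewrite cardE -(size_map comb) -ltnS; apply: leq_trans size_p.
apply: max_poly_roots => //; last by rewrite map_inj_uniq ?enum_uniq.
apply/allP => _ /mapP[v vA ->]; rewrite rootE pE f_comb.
by move: vA; rewrite mem_enum inE.
Qed.
End Linearized.

(** * Systematic encoders with bounded window kernels *)

Section WindowedCode.

Variables (F : finFieldType) (L : fieldExtType F).
Local Notation q := #|F|.
Local Notation N := (\dim {: L}).

Definition window_kernel M (c : nat -> L) : {set {ffun 'I_M -> F}} :=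
  [set v : {ffun 'I_M -> F} | \sum_j v j *: c j == 0].

(** Column 0 contributes nothing, so its coefficient takes at most q values while the others form a
    kernel vector of the shifted window. *)
Lemma card_window_kernelS M (c : nat -> L) : c 0 = 0 ->
  (#|window_kernel M.+1 c| <= q * #|window_kernel M (fun j => c j.+1)|)%N.
Proof.
move=> c0; pose h (v : {ffun 'I_M.+1 -> F}) := (v ord0, [ffun j => v (lift ord0 j)]).
have h_inj : injective h.
  move=> v w [vw0 vwS]; apply/ffunP => j; case: (unliftP ord0 j) => [i ->|-> //].
  by move/ffunP/(_ i): vwS; rewrite !ffunE.
rewrite -(card_imset _ h_inj) -cardsT -cardsX; apply: subset_leq_card.
apply/subsetP=> _ /imsetP[v vK ->]; rewrite !inE /=.
move: vK; rewrite inE big_ord_recl c0 scaler0 add0r.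
by under eq_bigr do rewrite ffunE.
Qed.

Definition encode k (G : nat -> nat -> L) (u : nat -> L) j :=
  \sum_(i < k) u i * G i j.

(* When the first [t] information symbols vanish, so do the first [t] columns,
   and the bound says that the columns [t, ..., t + N - 1] span a space of
   dimension at least [N - (k - 1) + t]. *)
Definition windowed_code k (G : nat -> nat -> L) := forall t (u : nat -> L),
  (forall i, (i < t)%N -> u i = 0) -> (exists2 i, (i < k)%N & u i != 0) ->
  (#|window_kernel (t + N) (encode k G u)| <= q ^ k.-1)%N.

(** The middle clause strengthens the induction: by root counting it yields the window bound at
    [t = 0]. For larger [t], dropping column 0 leads back to the smaller code. *)
Lemma exists_windowed_code k (al : seq L) :
    size al = N -> free al -> (k <= N)%N ->
  exists G : nat -> nat -> L,
    [/\ forall i j, (i < k)%N -> (j < k)%N -> G i j = (i == j)%:R,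
        forall u, exists2 f, linearized k f &
          forall j, (j < N)%N -> encode k G u j = f al`_j
      & windowed_code k G].
Proof.
elim: k al => [|k IHk] al sz_al al_free k_le.
  exists (fun _ _ => 0); split=> // [u|t u _ [] //].
  exists (fun=> 0); last by move=> j _; rewrite /encode big_ord0.
  by exists (fun=> 0) => x; rewrite big_ord0.
case: al sz_al al_free => [/esym sz0|a s /= sz_s as_free].
  by rewrite sz0 in k_le.
have s_free := free_annihilator as_free.
pose be0 := map (annihilator a) s.
(* The N - 1 points of [be0] cannot span [L], so an N-th independent point is available. *)
have [b be_free] : exists b, free (b :: be0).
  have : ~~ ({: L} <= <<be0>>)%VS.
    apply/negP => /dimvS; rewrite leqNgt => /negP[].
    by rewrite (eqP s_free) size_map -sz_s.
  by case/subvPn => b _ bs; exists b; rewrite free_cons bs.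
have sz_be : size (rcons be0 b) = N by rewrite size_rcons size_map.
have {}be_free : free (rcons be0 b).
  by rewrite (perm_free (permEl (perm_rcons _ _))).
have [G1 [G1sys G1lin G1win]] := IHk _ sz_be be_free (ltnW k_le).
have k_le_s : (k <= size s)%N by rewrite -ltnS sz_s.
(* [f0] will encode the first symbol; its values 1, 0, ..., 0 at the first k + 1 points make that
   row systematic. *)
have [f0 f0_lin [f0a f0s]] : exists2 f, linearized k.+1 f &
    f a = 1 /\ {in take k s, forall y, f y = 0}.
  have := @exists_interpolant F L a (take k s); rewrite size_takel //; apply.
  by apply: (@catl_free _ _ (drop k s)); rewrite cat_cons cat_take_drop.
(* Past the N points row 0 uses the default point 0. Only windows with [t > 0] reach there, and for
   them [u 0 = 0]. *)
pose G i j := if i is i'.+1 then (if j is j'.+1 then G1 i' j' else 0)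
              else f0 (a :: s)`_j.
have encS u j :
    encode k.+1 G u j.+1 = u 0 * f0 s`_j + encode k G1 (fun i => u i.+1) j.
  by rewrite /encode big_ord_recl.
have enc0 u : encode k.+1 G u 0 = u 0.
  by rewrite /encode big_ord_recl /= f0a mulr1 big1 ?addr0 // => i _; rewrite mulr0.
have Glin u : exists2 f, linearized k.+1 f &
    forall j, (j < N)%N -> encode k.+1 G u j = f (a :: s)`_j.
  have [g g_lin gE] := G1lin (fun i => u i.+1).
  exists (fun x => u 0 * f0 x + 1 * g (annihilator a x)).
    exact/linearized_comb/linearized_annihilator.
  case=> [_|j].
    by rewrite enc0 /= f0a annihilator_id (linearized0 g_lin) mulr0 addr0 mulr1.
  rewrite -sz_s ltnS => js; rewrite encS /= mul1r gE; last by rewrite -sz_s ltnW.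
  by rewrite nth_rcons size_map js (nth_map 0).
have Gsys i j : (i < k.+1)%N -> (j < k.+1)%N -> G i j = (i == j)%:R.
  case: i j => [|i] [|j] //=; rewrite !ltnS => ik jk; last exact: G1sys.
  rewrite f0s // -(@nth_take k _ 0 j jk) mem_nth // size_takel //.
exists G; split=> //.
case=> [|t] u ut [j jk uj].
  have [f f_lin fE] := Glin u.
  have al_size : size (a :: s) == N by rewrite /= sz_s.
  pose al : N.-tuple L := Tuple al_size.
  have enc_j : encode k.+1 G u j = u j.
    rewrite /encode (bigD1 (Ordinal jk)) //= Gsys // eqxx mulr1 big1 ?addr0 // => i.
    by rewrite -val_eqE /= => /negPf ij; rewrite Gsys // ij mulr0.
  apply: leq_trans (card_linearized_roots (al := al) f_lin as_free _).
    rewrite subset_leq_card //; apply/subsetP => v; rewrite !inE.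
    by under eq_bigr do rewrite fE //.
  by exists (a :: s)`_j; rewrite -fE ?enc_j // (leq_trans jk).
case: j jk uj => [|j]; rewrite ?ltnS => jk uj; first by rewrite ut ?eqxx in uj.
have u0 : u 0 = 0 by apply: ut.
(* Column 0 vanishes and costs a factor q; the remaining columns form a codeword of [G1], whose
   bound is q^(k-1). *)
apply: leq_trans (card_window_kernelS _ _) _; first by rewrite enc0.
have k_gt0 : (0 < k)%N := leq_ltn_trans (leq0n j) jk.
rewrite /= -[in (q ^ k)%N](prednK k_gt0) expnS leq_mul2l; apply/orP; right.
apply: leq_trans (G1win t (fun i => u i.+1) _ _); last by exists j.
  rewrite subset_leq_card //; apply/subsetP => v; rewrite !inE.
  by under eq_bigr do rewrite encS u0 mul0r add0r.
by move=> i it; apply: ut.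
Qed.

End WindowedCode.

(** The same encoder in coordinates: a basis turns elements of [L] into rows over [F], and row i of
    [U] is the i-th information symbol. *)
Lemma exists_windowed_matrix_code (F : finFieldType) (N k : nat) :
    (0 < N)%N -> (k <= N)%N ->
  exists E : nat -> 'M[F]_(k, N) -> 'rV[F]_N,
    [/\ forall j, linear (E j),
        forall (j : 'I_k) U, E j U = row j U
      & forall t U, U != 0 -> (forall j : 'I_k, (j < t)%N -> row j U = 0) ->
        (#|[set v : {ffun 'I_(t + N) -> F} | (\sum_j v j *: E j U == 0)%R]|
           <= #|F| ^ k.-1)%N].
Proof.
move=> N_gt0 k_le; have [L dimL] := fieldExt_of_dim F N_gt0.
case: N / dimL N_gt0 k_le => _ k_le.
pose e := vbasis {: L}; have e_basis : basis_of {: L} e := vbasisP _.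
have [|G [Gsys _ Gwin]] := @exists_windowed_code F L k e _ (basis_free e_basis) k_le.
  exact: size_tuple.
pose info (U : 'M[F]_(k, \dim {: L})) i : L :=
  oapp (fun j => vecof e (row j U)) 0 (insub i).
have infoE U (i : 'I_k) : info U i = vecof e (row i U) by rewrite /info valK.
have info0 U i : (forall j : 'I_k, (j : nat) = i -> row j U = 0) -> info U i = 0.
  move=> Ui; rewrite /info; case: insubP => //= j _ ji.
  by rewrite Ui // linear0.
exists (fun j U => rVof e (encode k G (info U) j)); split.
- move=> j c U V; rewrite -linearP; congr rVof.
  rewrite /encode scaler_sumr -big_split; apply: eq_bigr => i _ /=.
  by rewrite !infoE linearP linearP mulrDl scalerAl.
- move=> j U; apply: (canLR (vecofK e_basis)).
  rewrite /encode (bigD1 j) //= Gsys // eqxx mulr1 infoE big1 ?addr0 // => i.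
  by rewrite -val_eqE /= => /negPf ij; rewrite Gsys // ij mulr0.
move=> t U U_neq0 Ut.
have info_lt i : (i < t)%N -> info U i = 0.
  by move=> it; apply: info0 => j ji; apply: Ut; rewrite ji.
have info_neq0 : exists2 i, (i < k)%N & info U i != 0.
  have [j Uj] : exists j, row j U != 0.
    apply/existsP; apply: contraR U_neq0; rewrite negb_exists => /forallP U0.
    by apply/eqP/row_matrixP => j; rewrite row0; have /eqP := negbNE (U0 j).
  by exists (j : nat) => //; rewrite infoE vecof_eq0.
apply: leq_trans (Gwin t (info U) info_lt info_neq0).
apply: subset_leq_card; apply/subsetP => v; rewrite !inE.
rewrite -(rVof_eq0 e_basis) linear_sum.
by under [in X in _ -> X]eq_bigr do rewrite linearZ.
Qed.

(** * Rank estimates and the upper bound on the dimension *)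

Lemma mul_pid_mxE (R : pzRingType) m n (A : 'M[R]_(m, n)) r x y :
  (pid_mx r *m A) x y = if (x < r)%N then A x y else 0.
Proof.
rewrite mxE (bigD1 x) //= mxE eqxx /= big1 ?addr0.
  by case: ifP; rewrite ?mul1r ?mul0r.
by move=> j jx; rewrite mxE val_eqE eq_sym (negPf jx) mul0r.
Qed.

(** The first [i] rows have rank at most [i]; what is left lives in the last [s] columns. *)
Lemma rank_outside_zero (F : fieldType) m n (A : 'M[F]_(m, n)) (i s : nat) :
  (forall (x : 'I_m) (y : 'I_n), (i <= x)%N -> (y < n - s)%N -> A x y = 0) ->
  (\rank A <= i + s)%N.
Proof.
move=> A0; have [m_le|/ltnW i_le] := leqP m i.
  exact: leq_trans (rank_leq_row A) (leq_trans m_le (leq_addr _ _)).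
pose B := A - pid_mx i *m A.
have B0 (x : 'I_m) (y : 'I_n) : (x < i)%N || (y < n - s)%N -> B x y = 0.
  rewrite mxE [X in _ + X]mxE mul_pid_mxE.
  case: ltnP => [_ _|ix /=]; first exact: subrr.
  by move/A0 => ->; rewrite ?subrr.
have BE : B = B *m copid_mx (n - s).
  rewrite mulmxBr mulmx1 -[B *m _]trmxK trmx_mul tr_pid_mx.
  have -> : pid_mx (n - s) *m B^T = 0 :> 'M[F]_(n, m); last by rewrite trmx0 subr0.
  apply/matrixP => y x; rewrite mul_pid_mxE [RHS]mxE; case: ifP => // y_lt.
  by rewrite mxE B0 // y_lt orbT.
rewrite -[A](subrK (pid_mx i *m A)) -/B addrC BE.
apply: leq_trans (mxrank_add _ _) (leq_add _ _).
  by apply: leq_trans (mxrankM_maxl _ _) _; rewrite rank_pid_mx.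
apply: leq_trans (mxrankM_maxr _ _) _; rewrite rank_copid_mx ?leq_subr //; lia.
Qed.

(** Reading off the entries at the counted dots is injective on [C]: a codeword vanishing there has
    rank at most delta - 1, so it is zero. *)
Lemma ferrers_code_dim_le m n (D : {set 'I_m * 'I_n}) (F : finFieldType) k delta
    (C : {vspace 'M[F]_(m, n)}) i :
  ferrers_code D k delta C -> (i < delta)%N -> (k <= remaining_dots D delta i)%N.
Proof.
case=> <- Csupp Crank i_lt; rewrite /remaining_dots; set T := [set d in D | _].
pose proj (A : 'M[F]_(m, n)) := \row_(j < #|T|) A (enum_val j).1 (enum_val j).2.
have proj_linear : linear proj by move=> c A B; apply/rowP => j; rewrite !mxE.
pose projL : {linear _ -> _} :=
  HB.pack proj (GRing.isLinear.Build _ _ _ _ proj proj_linear).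
have projE A : linfun projL A = proj A by rewrite lfunE.
rewrite -(@limg_dim_eq _ _ _ (linfun projL)).
  by rewrite (leq_trans (dimvS (subvf _))) // dimvf dim_matrix mul1r.
apply/eqP; rewrite -subv0; apply/subvP => A; rewrite memv_cap memv_ker projE memv0.
case/andP=> AC /eqP A0; apply: contraT => /(Crank _ AC) rA.
suff : (\rank A <= i + (delta - 1 - i))%N by lia.
apply: rank_outside_zero => x y ix y_lt.
have [xyD|] := boolP ((x, y) \in D); last exact: Csupp.
have xyT : (x, y) \in T by rewrite inE xyD ix.
by have /rowP/(_ (enum_rank_in xyT (x, y))) := A0; rewrite !mxE enum_rankK_in.
Qed.

Lemma rank_ge_card_kernel (F : finFieldType) m n (A : 'M[F]_(m, n)) c :
  (#|[set v : 'rV[F]_n | (v *m A^T == 0)%R]| <= #|F| ^ c)%N -> (n - c <= \rank A)%N.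
Proof.
have -> : [set v : 'rV[F]_n | v *m A^T == 0] = rowg (kermx A^T).
  by apply/setP => v; rewrite !inE sub_kermx.
rewrite card_rowg leq_exp2l ?finNzRing_gt1 // mxrank_ker mxrank_tr; lia.
Qed.

Local Open Scope nat_scope.

(** * Columns of a Ferrers diagram and its dot counts *)

Section FerrersColumns.

Variables (m n : nat) (D : {set 'I_m * 'I_n}).
Hypothesis D_ferrers : ferrers_diagram D.

Lemma col_dotsE (j : 'I_n) : col_dots D j = #|[set x : 'I_m | (x, j) \in D]|.
Proof.
have pair_inj : injective (fun x : 'I_m => (x, j)) by move=> x y [].
rewrite -(card_imset _ pair_inj); apply/eq_card => -[x y].
rewrite !inE /=; apply/andP/imsetP.
  by case=> xyD /eqP/val_inj <-; exists x; rewrite ?inE.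
by case=> z; rewrite inE => zD [-> ->].
Qed.

Lemma ferrers_up (x x' : 'I_m) (j : 'I_n) :
  x' <= x -> (x, j) \in D -> (x', j) \in D.
Proof.
have [up _ _ _] := D_ferrers.
move: {2}(x - x') (erefl (x - x')) => k; elim: k x => [|k IHk] x.
  by move=> xx x_le; rewrite (_ : x = x') //; apply: val_inj => /=; lia.
move=> xx x_le xD; have y_lt : x.-1 < m by have := ltn_ord x; lia.
apply: (IHk (Ordinal y_lt)) => /=; try lia.
by apply: up xD => /=; lia.
Qed.

Lemma ferrers_right (x : 'I_m) (j j' : 'I_n) :
  j <= j' -> (x, j) \in D -> (x, j') \in D.
Proof.
have [_ right _ _] := D_ferrers.
move: {2}(j' - j) (erefl (j' - j)) => k; elim: k j => [|k IHk] j.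
  by move=> jj j_le; rewrite (_ : j = j') //; apply: val_inj => /=; lia.
move=> jj j_le xD; have y_lt : j.+1 < n by have := ltn_ord j'; lia.
apply: (IHk (Ordinal y_lt)) => /=; try lia.
by apply: right xD => /=; lia.
Qed.

(** By top alignment, if [(x, j)] is missing then all dots of column [j] lie above row [x], and
    there are at most [x] of them. *)
Lemma mem_lt_col_dots (x : 'I_m) (j : 'I_n) : x < col_dots D j -> (x, j) \in D.
Proof.
apply: contraTT => xD; rewrite -leqNgt col_dotsE.
apply: leq_trans (_ : #|[set y : 'I_m | y < x]| <= x).
  apply: subset_leq_card; apply/subsetP => y; rewrite !inE => yD.
  by rewrite ltnNge; apply: contra xD => /ferrers_up; apply.
rewrite cardsE cardE -(size_map val) -[leqRHS](size_iota 0).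
apply: uniq_leq_size; first by rewrite (map_inj_uniq val_inj) enum_uniq.
by move=> _ /mapP[y + ->]; rewrite mem_enum mem_iota.
Qed.

Lemma col_dots_le_rows (j : 'I_n) : col_dots D j <= m.
Proof. by rewrite col_dotsE (leq_trans (max_card _)) ?card_ord. Qed.

Lemma col_dots_mono (j j' : 'I_n) : j <= j' -> col_dots D j <= col_dots D j'.
Proof.
move=> jj; rewrite !col_dotsE; apply: subset_leq_card; apply/subsetP => x.
by rewrite !inE; apply: ferrers_right.
Qed.

(** The n dots of row 0 lie in distinct columns, hence meet all n of them. *)
Lemma col_dots_gt0 (j : 'I_n) : 0 < col_dots D j.
Proof.
have [_ _ row0 _] := D_ferrers.
have row0_inj : {in [set d in D | d.1 == 0 :> nat] &, injective snd}.
  move=> [x y] [x' y']; rewrite !inE /= => /andP[_ /eqP x0] /andP[_ /eqP x'0] ->.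
  by congr (_, _); apply: val_inj; rewrite /= x0.
have : j \in [set d.2 | d in [set d in D | d.1 == 0 :> nat]].
  suff -> : [set d.2 | d in [set d in D | d.1 == 0 :> nat]] = [set: 'I_n].
    by rewrite inE.
  apply/eqP; rewrite eqEcard subsetT /= (card_in_imset row0_inj) cardsT card_ord.
  by rewrite -[leqRHS]/(row_dots D 0) row0.
case/imsetP => -[x y]; rewrite inE => /andP[/= xyD _] ->.
by rewrite col_dotsE; apply/card_gt0P; exists x; rewrite inE.
Qed.

End FerrersColumns.

Lemma card_left_columns m n (D : {set 'I_m * 'I_n}) c :
  #|[set d in D | d.2 < c]| = \sum_(0 <= j < c) col_dots D j.
Proof.
elim: c => [|c IHc].
  rewrite big_geq //; apply/eqP; rewrite cards_eq0; apply/eqP/setP=> d.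
  by rewrite !inE andbF.
rewrite big_nat_recr //= -IHc /col_dots -cardsUI.
rewrite (_ : _ :&: _ = set0) ?cards0 ?addn0.
  by apply: eq_card => d; rewrite !inE -andb_orr ltnS leq_eqVlt orbC.
by apply/setP => d; rewrite !inE; case: (d \in D) => //=; lia.
Qed.

Lemma remaining_dots0 m n (D : {set 'I_m * 'I_n}) delta : 0 < delta ->
  remaining_dots D delta 0 = \sum_(0 <= j < n - (delta - 1)) col_dots D j.
Proof.
by move=> delta_gt0; rewrite -card_left_columns /remaining_dots subn0.
Qed.

(** The code itself bounds every v_i below by [k], so the minimum is attained at v_0. *)
Lemma dim_bound_eq m n (D : {set 'I_m * 'I_n}) (F : finFieldType) k delta
    (C : {vspace 'M[F]_(m, n)}) :
  ferrers_code D k delta C -> remaining_dots D delta 0 = k -> dim_bound D delta = k.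
Proof.
move=> C_code v0; apply/eqP; rewrite eqn_leq; apply/andP; split.
  rewrite /dim_bound v0; elim/big_rec: _ => // i x _ le_x.
  exact: leq_trans (geq_minr _ _) le_x.
rewrite /dim_bound v0; elim/big_rec: _ => // i x _ k_le.
by rewrite leq_min k_le (ferrers_code_dim_le C_code).
Qed.

(** * The codeword of an information vector, its support and its rank *)

Lemma block_index (off : nat -> nat) r p : off 0 = 0 ->
  exists t, [/\ t <= r, off t <= p & t < r -> p < off t.+1].
Proof.
move=> off0; elim: r => [|r [t [tr Stp tS]]]; first by exists 0; rewrite off0.
have [Sr|Sr] := leqP (off r.+1) p; first by exists r.+1; rewrite ltnn.
exists t; split=> //; first exact: leqW.
by rewrite ltnS leq_eqVlt => /predU1P[-> | /tS].
Qed.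

Section Entry.

Variables (F : fieldType) (d : nat).

Definition entry (v : 'rV[F]_d) (p : nat) : F := oapp (v 0%R) 0%R (insub p).

Lemma entry_ord v (i : 'I_d) : entry v i = v 0%R i.
Proof. by rewrite /entry valK. Qed.

Lemma entryP c v w p : entry (c *: v + w)%R p = (c * entry v p + entry w p)%R.
Proof. by rewrite /entry; case: insub => [i|] /=; rewrite ?mxE ?mulr0 ?addr0. Qed.

Lemma entry_neq0 v : v != 0%R ->
  exists p, [/\ p < d, entry v p != 0%R & forall p', p' < p -> entry v p' = 0%R].
Proof.
move=> v_neq0; have ex_p : exists p, entry v p != 0%R.
  have [i vi] : exists i, v 0%R i != 0%R.
    apply/existsP; apply: contraR v_neq0; rewrite negb_exists => /forallP v0.
    by apply/eqP/rowP => i; rewrite mxE; apply/eqP/negbNE.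
  by exists i; rewrite entry_ord.
case: (ex_minnP ex_p) => p vp p_min; exists p; split=> //.
  by apply: contraR vp; rewrite /entry; case: insubP => //= i ->.
move=> p' p'p; apply/eqP; apply: contraTT p'p => /p_min.
by rewrite -leqNgt.
Qed.

End Entry.

Section ExtendedMatrix.

Variables (F : finFieldType) (m n r k : nat) (gam : nat -> nat).
Local Notation N := (n - r).
Local Notation off j := (\sum_(0 <= i < j) gam i).
Variable E : nat -> 'M[F]_(k, N) -> 'rV[F]_N.

(** The zero padding of each block keeps the systematic column [j] within its [gam j] dots. *)
Definition info_matrix (w : 'rV[F]_(off k)) : 'M[F]_(k, N) :=
  \matrix_(j, a) if a < gam j then entry w (off j + a) else 0%R.

(* The part below row [N] is of Hankel type: read upwards from its last entry,
   column [N + i] lists the first [off i.+1] information symbols. *)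
Definition extended_matrix (w : 'rV[F]_(off k)) : 'M[F]_(m, n) :=
  \matrix_(x, y)
    if x < N then entry (E y (info_matrix w)) x
    else if (N <= y) && (x - N < off (y - N).+1)
         then entry w ((off (y - N).+1).-1 - (x - N)) else 0%R.

Hypothesis E_linear : forall j, linear (E j).
Hypothesis E_sys : forall (j : 'I_k) U, E j U = row j U.
Hypothesis E_win : forall t U, U != 0%R ->
  (forall j : 'I_k, j < t -> row j U = 0%R) ->
  #|[set v : {ffun 'I_(t + N) -> F} | (\sum_j v j *: E j U == 0)%R]|
    <= #|F| ^ k.-1.

Lemma off_mono i j : i <= j -> off i <= off j.
Proof. by move=> ij; rewrite (big_cat_nat (leq0n i) ij) leq_addr. Qed.

Lemma off_recr j : off j.+1 = off j + gam j.
Proof. by rewrite big_nat_recr. Qed.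

Lemma info_matrix_linear : linear info_matrix.
Proof.
move=> c v w; apply/matrixP => j a; rewrite !mxE.
by case: ifP => _; rewrite ?entryP ?mulr0 ?addr0.
Qed.

Lemma extended_matrix_linear : linear extended_matrix.
Proof.
move=> c v w; apply/matrixP => x y; rewrite !mxE info_matrix_linear E_linear.
by case: ifP => _; [|case: ifP => _]; rewrite ?entryP ?mulr0 ?addr0.
Qed.

Hypothesis r_le : r <= n.
Hypothesis N_le_m : N <= m.
Hypothesis gam_gt0 : forall j, j < n -> 0 < gam j.
Hypothesis gam_le_m : forall j, j < n -> gam j <= m.
Hypothesis gam_info : forall j, j < k -> gam j <= N.
Hypothesis gam_last : forall i, i < r -> N + off i.+1 <= gam (N + i).
Hypothesis r_le_k : r <= k.

(** Above row [N], information columns are zero-padded and the other columns have dots in all [N]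
    rows. Below it, [gam_last] leaves room for the repeated symbols. *)
Lemma extended_matrix_supp w (x : 'I_m) (y : 'I_n) :
    (forall j, k <= j < n -> N <= gam j) -> gam y <= x ->
  extended_matrix w x y = 0%R.
Proof.
move=> gam_parity yx; rewrite mxE; case: ifP => [xN|/negbT].
  have y_lt : y < k.
    rewrite ltnNge; apply/negP => ky.
    by have := gam_parity y; rewrite ky ltn_ord; lia.
  rewrite (E_sys (Ordinal y_lt)).
  have -> : (x : nat) = Ordinal xN by [].
  by rewrite entry_ord !mxE /= ltnNge yx.
rewrite -leqNgt => Nx; case: ifP => // /andP[Ny xS].
have yr : y - N < r by have := ltn_ord y; lia.
by have := gam_last yr; rewrite subnKC //; lia.
Qed.

Lemma extended_matrix_kernel w (v : 'rV[F]_n) (x : 'I_m) :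
  (v *m (extended_matrix w)^T = 0)%R ->
  (\sum_(y < n) v 0 y * extended_matrix w x y = 0)%R.
Proof.
move=> /rowP/(_ x); rewrite mxE [RHS]mxE => sum0.
by rewrite -[RHS]sum0; apply: eq_bigr => y _; rewrite [(_^T)%R _ _]mxE.
Qed.

(* The first nonzero information symbol, at position [p], is the last nonzero
   entry of each of the columns [N + t, ..., n - 1], in strictly increasing
   rows. *)
Lemma extended_matrix_kernel_tail w p t (v : 'rV[F]_n) :
    entry w p != 0%R -> (forall p', p' < p -> entry w p' = 0%R) ->
    (t < r -> p < off t.+1) -> (v *m (extended_matrix w)^T = 0)%R ->
  forall y : 'I_n, t + N <= y -> v 0%R y = 0%R.
Proof.
move=> wp wp0 pt vM y0 y0_ge; apply/eqP; apply: contraT => vy0.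
pose P (y : 'I_n) := (t + N <= y) && (v 0%R y != 0%R).
have Py0 : P y0 by rewrite /P y0_ge.
(* For the last column [y] with [v] nonzero, consider row N + rho, where [y] shows symbol [p].
   Columns to the right have coefficient 0; those to the left show 0 or symbols before [p]. Thus one
   nonzero term remains. *)
case: (arg_maxnP (fun y : 'I_n => y : nat) Py0) => y /andP[y_ge vy] y_max.
have y_lt := ltn_ord y.
have pS : p < off (y - N).+1.
  by apply: leq_trans (pt _) (off_mono _); lia.
pose rho := (off (y - N).+1).-1 - p.
have x_lt : N + rho < m.
  have yr : y - N < r by lia.
  have := gam_last yr; rewrite subnKC; last by lia.
  by have := gam_le_m y_lt; rewrite /rho; lia.
have := extended_matrix_kernel (Ordinal x_lt) vM.
rewrite (bigD1 y) //= big1 ?addr0.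
  rewrite mxE /= ltnNge leq_addr /= addKn.
  have -> : N <= y by lia.
  have -> /= : rho < off (y - N).+1 by rewrite /rho; lia.
  have -> : (off (y - N).+1).-1 - rho = p by rewrite /rho; lia.
  by move/eqP; rewrite mulf_eq0 (negPf vy) (negPf wp).
move=> y' y'y; have [y_lt'|y'_le] := ltnP y y'.
  have [->|vy'] := eqVneq (v 0%R y') 0%R; first by rewrite mul0r.
  have := y_max y'; rewrite /P vy' andbT => /(_ _).
  by lia.
rewrite mxE /= ltnNge leq_addr /= addKn.
case: ifP => [/andP[Ny' rho_lt]|_]; last by rewrite mulr0.
have y'_lt : y' < y by rewrite ltn_neqAle y'_le andbT.
rewrite wp0 ?mulr0 //.
have gam_pos : 0 < gam (y' - N).+1 by apply: gam_gt0; lia.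
have le_off : off (y' - N).+2 <= off (y - N).+1 by apply: off_mono; lia.
by rewrite [off _.+2]off_recr in le_off; rewrite /rho; lia.
Qed.

Lemma extended_matrix_rank w : w != 0%R -> n - k.-1 <= \rank (extended_matrix w).
Proof.
case/entry_neq0 => p [p_lt wp wp0].
have off0 : off 0 = 0 by rewrite big_geq.
(* Among the first [r] blocks, exactly [t] end before the first nonzero symbol [p]. *)
have [t [tr Stp pt]] := block_index (off := fun j => off j) r p off0.
pose U := info_matrix w.
have U_neq0 : U != 0%R.
  have [j [j_le Sjp pj]] := block_index (off := fun j => off j) k p off0.
  have j_lt : j < k.
    by rewrite ltn_neqAle j_le andbT; apply: contraTneq p_lt => <-; rewrite -leqNgt.
  have pjj := pj j_lt; rewrite off_recr in pjj.
  have a_lt : p - off j < N by have := gam_info j_lt; lia.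
  apply: contraNneq wp => /matrixP/(_ (Ordinal j_lt) (Ordinal a_lt)).
  rewrite !mxE /= subnKC // => <-; case: ifP => //; lia.
have Ut (j : 'I_k) : j < t -> row j U = 0%R.
  move=> jt; apply/rowP => a; rewrite !mxE; case: ifP => // a_lt; apply: wp0.
  by have := off_mono jt; rewrite off_recr; lia.
apply: rank_ge_card_kernel; apply: leq_trans (E_win U_neq0 Ut).
(* Restriction to the window loses nothing on the kernel, whose vectors vanish beyond it. *)
pose h (v : 'rV[F]_n) := [ffun y : 'I_(t + N) => entry v y].
have tN_le : t + N <= n by lia.
set K := [set v | _].
have tail v : v \in K -> forall y : 'I_n, t + N <= y -> v 0%R y = 0%R.
  by rewrite inE => /eqP vM; apply: (extended_matrix_kernel_tail wp wp0 pt).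
have h_inj : {in K &, injective h}.
  move=> v v' /tail vK /tail v'K /ffunP hvv'; apply/rowP => y.
  have [y_lt|y_ge] := ltnP y (t + N); last by rewrite vK ?v'K.
  by have := hvv' (Ordinal y_lt); rewrite !ffunE /= !entry_ord.
rewrite -(card_in_imset h_inj); apply: subset_leq_card.
apply/subsetP => _ /imsetP[v vK ->]; rewrite inE.
have vM : (v *m (extended_matrix w)^T = 0)%R by apply/eqP; rewrite inE in vK.
apply/eqP/rowP => a; rewrite summxE [RHS]mxE.
have a_lt : a < m by apply: leq_trans N_le_m.
rewrite -[RHS](extended_matrix_kernel (Ordinal a_lt) vM).
transitivity (\sum_(0 <= y < t + N) entry v y * entry (E y U) a)%R.
  by rewrite big_mkord; apply: eq_bigr => y _; rewrite ffunE mxE entry_ord.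
transitivity (\sum_(0 <= y < n) entry v y * entry (E y U) a)%R; last first.
  rewrite big_mkord; apply: eq_bigr => y _.
  by rewrite entry_ord mxE /= ltn_ord.
rewrite [RHS](big_cat_nat (leq0n _) tN_le) /= [X in _ = (_ + X)%R]big_nat_cond.
rewrite [X in _ = (_ + X)%R]big1 ?addr0 // => y /andP[/andP[y_ge y_lt] _].
have /= := tail v vK (Ordinal y_lt) y_ge; rewrite -entry_ord /= => ->.
by rewrite mul0r.
Qed.

End ExtendedMatrix.

(** * Assembling the optimal code from the column conditions *)

Theorem theorem3p11 (F : finFieldType) (delta n r m : nat)
    (delta_gt0 : 0 < delta) (n_gt0 : 0 < n) (r_gt0 : 0 < r)
    (r_lt_delta : r + 1 <= delta) (delta_le : delta <= n - r)
    (D : {set 'I_m * 'I_n}) (D_ferrers : ferrers_diagram D)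
    (cond1 : col_dots D (n - r - 1) <= n - r)
    (cond2 : forall i : nat, i < r ->
       n - r + \sum_(0 <= j < i.+1) col_dots D j <= col_dots D (n - r + i))
    (cond3 : forall i : nat, n - delta + 1 <= i <= n - 1 ->
       n - r <= col_dots D i) :
  exists C : {vspace 'M[F]_(m, n)},
    optimal_ferrers_code D (\sum_(0 <= i < (n - delta).+1) col_dots D i)
      delta C.
Proof.
set k := (n - delta).+1; pose gam := col_dots D.
have N_gt0 : 0 < n - r by lia.
have k_le : k <= n - r by rewrite /k; lia.
have gam_gt0 j : j < n -> 0 < gam j.
  by move=> jn; apply: (col_dots_gt0 D_ferrers (Ordinal jn)).
have gam_le_m j : j < n -> gam j <= m.
  by move=> jn; apply: (col_dots_le_rows D (Ordinal jn)).
have N_le_m : n - r <= m.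
  have last_lt : n - 1 < n by lia.
  by apply: leq_trans (gam_le_m _ last_lt); apply: cond3; lia.
(* As r + 1 <= delta, information columns lie no further right than column n - r - 1, so
   monotonicity and [cond1] apply. *)
have gam_info j : j < k -> gam j <= n - r.
  move=> jk; apply: leq_trans cond1.
  have j_lt : j < n by lia.
  have l_lt : n - r - 1 < n by lia.
  apply: (col_dots_mono D_ferrers (j := Ordinal j_lt) (j' := Ordinal l_lt)).
  by rewrite /=; lia.
have gam_parity j : k <= j < n -> n - r <= gam j by move=> jn; apply: cond3; lia.
have [E [E_lin E_sys E_win]] := exists_windowed_matrix_code F N_gt0 k_le.
pose M := extended_matrix m (gam := gam) E.
have M_linear : linear M by apply: extended_matrix_linear.
pose ML : {linear _ -> _} := HB.pack M (GRing.isLinear.Build _ _ _ _ M M_linear).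
have ME w : linfun ML w = M w by rewrite lfunE.
have M_rank w : w != 0%R -> delta <= \rank (M w).
  move=> w_neq0; have -> : delta = n - k.-1 by rewrite /k; lia.
  by apply: extended_matrix_rank => //; rewrite /k; lia.
pose C := limg (linfun ML).
have C_code : ferrers_code D (\sum_(0 <= i < k) gam i) delta C.
  split.
  (* Nonzero [w] give matrices of rank at least delta > 0, so the encoder is injective. *)
  - rewrite limg_dim_eq ?dimvf ?dim_matrix ?mul1r //.
    apply/eqP; rewrite -subv0; apply/subvP => w; rewrite memv_cap memv_ker ME memv0.
    case/andP=> _ /eqP Mw0; apply: contraT => /M_rank.
    by rewrite Mw0 mxrank0; lia.
  - move=> _ /memv_imgP[w _ ->] x y xyD; rewrite ME.
    apply: extended_matrix_supp => //; try by rewrite /k; lia.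
    by rewrite leqNgt; apply: contra xyD; apply: mem_lt_col_dots.
  - move=> _ /memv_imgP[w _ ->]; rewrite ME => Mw; apply: M_rank.
    by apply: contraNneq Mw => ->; rewrite -ME linear0.
exists C; split=> //; symmetry; apply: (dim_bound_eq C_code).
by rewrite remaining_dots0 // (_ : n - (delta - 1) = k) // /k; lia.
Qed.
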